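(* Let $\mathbf{X}=(X_1,\dots,X_d)$ be a continuous random vector in $\mathbb{R}^d$ with joint probability density function $f_X$ (the components $X_1,\dots,X_d$ are not assumed to be independent). Let $g:\mathbb{R}^d\to\mathbb{R}$ be a differentiable deterministic function whose partial derivatives are square integrable, i.e. $\mathbb{E}\big[(\partial g(\mathbf{X})/\partial x_j)^2\big]<\infty$ for $j=1,\dots,d$, and let $Y=g(\mathbf{X})$. Then for every $i\in\{1,\dots,d\}$, $$H_{T_i}\;\le\; H(X_i)+l_i ,$$ where $H_{T_i}=\mathbb{E}[H(Y\mid \mathbf{X}_{\sim i})]$ is the total effect entropy, $H(X_i)$ is the differential entropy of $X_i$, and $l_i=\mathbb{E}\left[\ln\left|\partial g(\mathbf{X})/\partial x_i\right|\right]$.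
   Context: All logarithms are natural. For a continuous random variable (or vector) $Z$ with density $f$, the differential entropy is $H(Z)=-\int f(z)\ln f(z)\,dz$, the integral being over the support of $Z$. $\mathbf{X}_{\sim i}$ denotes the vector of all inputs $X_1,\dots,X_d$ except $X_i$. The conditional differential entropy (total effect entropy) is $$H_{T_i}=\mathbb{E}[H(Y\mid \mathbf{X}_{\sim i})]=-\int f(y,\mathbf{x}_{\sim i})\ln f(y\mid \mathbf{x}_{\sim i})\,dy\,d\mathbf{x}_{\sim i},$$ where $f(y,\mathbf{x}_{\sim i})$ is the joint density of $(Y,\mathbf{X}_{\sim i})$ and $f(y\mid\mathbf{x}_{\sim i})$ is the conditional density of $Y$ given $\mathbf{X}_{\sim i}=\mathbf{x}_{\sim i}$. The expected log-derivative is $l_i=\int \ln\left|\partial g(\mathbf{x})/\partial x_i\right| f_X(\mathbf{x})\,d\mathbf{x}$. It is a standing assumption that the densities involved exist and that the entropies and expectations involved (including the joint entropies of $\mathbf{X}$, of $\mathbf{X}_{\sim i}$ and of $(Y,\mathbf{X}_{\sim i})$) are well defined and finite. *)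

(* Defs.v *)
From HB Require Import structures.
From mathcomp Require Import all_boot all_order all_algebra.
From mathcomp Require Import all_classical all_reals all_analysis.
Import Order.TTheory GRing.Theory Num.Theory.
Import numFieldNormedType.Exports.

Set Implicit Arguments.
Unset Strict Implicit.
Unset Printing Implicit Defensive.

Local Open Scope classical_set_scope.
Local Open Scope ring_scope.

(* Row vectors carry the product sigma-algebra, i.e. the one generated by the
   coordinate projections (as for [n.-tuple T]).  For real vectors this is the
   Borel sigma-algebra of R^n. *)
Definition measure_rV_display : measure_display -> measure_display.
Proof. exact. Qed.

Section measurable_rV.
Context {d} {T : sigmaRingType d}.
Variable n : nat.

Let coors : 'I_n -> 'rV[T]_n -> T := fun i x => x ord0 i.

Let rV_set0 : g_sigma_preimage coors set0.
Proof. exact: sigma_algebra0. Qed.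

Let rV_setC A : g_sigma_preimage coors A -> g_sigma_preimage coors (~` A).
Proof. exact: sigma_algebraC. Qed.

Let rV_bigcup (F : _^nat) : (forall i, g_sigma_preimage coors (F i)) ->
  g_sigma_preimage coors (\bigcup_i (F i)).
Proof. exact: sigma_algebra_bigcup. Qed.

HB.instance Definition _ := @isMeasurable.Build (measure_rV_display d)
  'rV[T]_n (g_sigma_preimage coors) rV_set0 rV_setC rV_bigcup.

End measurable_rV.

Lemma measurable_coord d (T : sigmaRingType d) n (i : 'I_n) :
  measurable_fun [set: 'rV[T]_n] (fun x => x ord0 i).
Proof.
move=> _ Y mY; rewrite setTI; apply: sub_sigma_algebra => /=.
rewrite -bigcup_seq/=; exists i => /=; first by rewrite mem_index_enum.
by exists Y => //; rewrite setTI.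
Qed.

Lemma measurable_fun_rVP d1 d2 (T1 : measurableType d1)
    (T2 : measurableType d2) n (f : T1 -> 'rV[T2]_n) :
  (forall i, measurable_fun [set: T1] (fun x => f x ord0 i)) ->
  measurable_fun [set: T1] f.
Proof.
move=> mf _ A mA; rewrite setTI.
have : <<s \big[setU/set0]_(i < n) preimage_set_system setT
   (fun x : 'rV[T2]_n => x ord0 i) measurable >> A by exact: mA.
rewrite -bigcup_seq; move: A {mA}; apply: smallest_sub.
  split=> [|A mA|F mF] /=; rewrite ?preimage_set0//.
  - by rewrite setTD preimage_setC; exact: measurableC.
  - by rewrite preimage_bigcup; exact: bigcup_measurable.
move=> A [i _] [B mB <-] /=; rewrite setTI.
by have := mf i measurableT B mB; rewrite setTI.
Qed.

Lemma product_measure1_sigma_finite d1 d2 (T1 : measurableType d1)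
    (T2 : measurableType d2) (R : realType)
    (m1 : {sigma_finite_measure set T1 -> \bar R})
    (m2 : {sigma_finite_measure set T2 -> \bar R}) :
  sigma_finite setT (m1 \x m2)%E.
Proof.
have /sigma_finiteP[F [TF ndF Foo]] := sigma_finiteT m1.
have /sigma_finiteP[G [TG ndG Goo]] := sigma_finiteT m2.
exists (fun k => F k `*` G k).
  rewrite -setXTT TF TG predeqE => -[x y]; split.
    move=> [/= [n _ Fnx] [k _ Gky]]; exists (maxn n k) => //; split.
    - by move: x Fnx; exact/subsetPset/ndF/leq_maxl.
    - by move: y Gky; exact/subsetPset/ndG/leq_maxr.
  by move=> [n _ []/= ? ?]; split; exists n.
move=> k; have [? ?] := Foo k; have [? ?] := Goo k.
split; first exact: measurableX.
by rewrite product_measure1E// lte_mul_pinfty// ge0_fin_numE.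
Qed.

(* n-dimensional Lebesgue measure, by induction on n: the unit mass on R^0, and
   the image of [lebesgue_measure \x mu] under (x, v) |-> (x, v_1, ..., v_n) on
   R^(n+1), where mu is the Lebesgue measure on R^n. *)
Section lebesgue_rV.
Variable R : realType.

Definition consrV n (p : measurableTypeR R * 'rV[R]_n) : 'rV[R]_n.+1 := row_mx p.1%:M p.2.

Lemma consrV0 n (p : measurableTypeR R * 'rV[R]_n) :
  consrV p ord0 ord0 = p.1.
Proof. by rewrite mxE; case: splitP => // k; rewrite ord1 mxE eqxx. Qed.

Lemma consrVS n (p : measurableTypeR R * 'rV[R]_n) i :
  consrV p ord0 (lift ord0 i) = p.2 ord0 i.
Proof.
rewrite mxE; case: splitP => [k|k /eqP]; first by rewrite ord1.
by rewrite /= /bump/= eqn_add2l => /eqP/val_inj ->.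
Qed.

Lemma measurable_consrV n : measurable_fun [set: measurableTypeR R * 'rV[R]_n] (@consrV n).
Proof.
apply: measurable_fun_rVP => i; case: (unliftP ord0 i) => [j|] ->.
  under eq_fun do rewrite consrVS.
  by apply: (measurableT_comp (measurable_coord j)); exact: measurable_snd.
under eq_fun do rewrite consrV0.
exact: measurable_fst.
Qed.

Definition unconsrV n (v : 'rV[R]_n.+1) : measurableTypeR R * 'rV[R]_n :=
  (v ord0 ord0, \row_j v ord0 (lift ord0 j)).

Lemma consrVK n : cancel (@consrV n) (@unconsrV n).
Proof.
move=> [x v]; rewrite /unconsrV consrV0; congr (_, _).
by apply/rowP => j; rewrite mxE consrVS.
Qed.

Lemma measurable_unconsrV n :
  measurable_fun [set: 'rV[R]_n.+1] (@unconsrV n).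
Proof.
apply: measurable_fun_pair; first exact: measurable_coord.
by apply: measurable_fun_rVP => i; under eq_fun do rewrite mxE;
  exact: measurable_coord.
Qed.

Section lebesgue_consrV.
Variables (n : nat) (mu : {sigma_finite_measure set 'rV[R]_n -> \bar R}).

Definition lebesgue_consrV : set 'rV[R]_n.+1 -> \bar R :=
  pushforward (@lebesgue_measure R \x mu)%E (@consrV n).

Let lebesgue_consrV0 : lebesgue_consrV set0 = 0%E.
Proof. by rewrite /lebesgue_consrV /pushforward preimage_set0 measure0. Qed.

Let lebesgue_consrV_ge0 A : (0 <= lebesgue_consrV A)%E.
Proof. by rewrite /lebesgue_consrV /pushforward measure_ge0. Qed.

Let lebesgue_consrV_sigma_additive : semi_sigma_additive lebesgue_consrV.
Proof.
move=> F mF tF mUF; rewrite /lebesgue_consrV /pushforward preimage_bigcup.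
apply: measure_semi_sigma_additive.
- by move=> k; rewrite -[X in measurable X]setTI; exact: measurable_consrV.
- apply/trivIsetP => /= i j _ _ ij; rewrite -preimage_setI.
  by move/trivIsetP : tF => /(_ _ _ _ _ ij) ->//; rewrite preimage_set0.
- rewrite -preimage_bigcup -[X in measurable X]setTI.
  exact: measurable_consrV.
Qed.

HB.instance Definition _ := isMeasure.Build _ _ _ lebesgue_consrV
  lebesgue_consrV0 lebesgue_consrV_ge0 lebesgue_consrV_sigma_additive.

Let lebesgue_consrV_sigma_finite : sigma_finite setT lebesgue_consrV.
Proof.
have [F TF Foo] := product_measure1_sigma_finite (@lebesgue_measure R) mu.
exists (fun k => @unconsrV n @^-1` F k).
  by rewrite -preimage_bigcup -TF preimage_setT.
move=> k; have [mF oo] := Foo k; split.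
  by rewrite -[X in measurable X]setTI; exact: measurable_unconsrV.
rewrite /lebesgue_consrV /pushforward -comp_preimage.
by rewrite (_ : _ \o _ = id)//; apply/funext => p /=; rewrite consrVK.
Qed.

HB.instance Definition _ := Measure_isSigmaFinite.Build _ _ _ lebesgue_consrV
  lebesgue_consrV_sigma_finite.

End lebesgue_consrV.

Fixpoint lebesgue_rV n : {sigma_finite_measure set 'rV[R]_n -> \bar R} :=
  match n with
  | 0 => \d_(0 : 'rV[R]_0)
  | n'.+1 => lebesgue_consrV (lebesgue_rV n')
  end.

Lemma lebesgue_rV_box n (A : 'I_n -> set R) : (forall i, measurable (A i)) ->
  lebesgue_rV n [set v | forall i, A i (v ord0 i)] =
  (\prod_(i < n) lebesgue_measure (A i))%E.
Proof.
elim: n A => [|n IHn] A mA.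
  by rewrite big_ord0 /= diracE mem_set//; case.
rewrite big_ord_recl -IHn//= /lebesgue_consrV /pushforward.
rewrite -(product_measure1E (lebesgue_measure : {sigma_finite_measure set _ -> \bar R}))//.
- congr (_ _); apply/seteqP; split=> -[x v] /=.
  + move=> h; split; first by have := h ord0; rewrite consrV0.
    by move=> i; have := h (lift ord0 i); rewrite consrVS.
  + by move=> [h0 hS] i; case: (unliftP ord0 i) => [j|] ->;
      rewrite ?consrVS ?consrV0.
- exact: mA.
- rewrite [X in measurable X](_ : _ = \bigcap_(i in [set: 'I_n])
      ((fun v : 'rV[R]_n => v ord0 i) @^-1` A (lift ord0 i))).
    apply: fin_bigcap_measurable => // i _.
    by rewrite -[X in measurable X]setTI; exact: measurable_coord.
  by apply/seteqP; split=> v /= h i; [move=> _|]; exact: h.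
Qed.

End lebesgue_rV.

Definition is_density d1 d2 (T : measurableType d1) (E : measurableType d2)
    (R : realType) (P : probability T R) (mu : {measure set E -> \bar R})
    (Z : T -> E) (f : E -> R) :=
  [/\ measurable_fun [set: E] f, forall z, 0 <= f z &
      forall A, measurable A ->
        pushforward P Z A = (\int[mu]_(z in A) (f z)%:E)%E].

Section entropy.
Context d (E : measurableType d) (R : realType).
Variables (mu : {measure set E -> \bar R}) (f : E -> R).

Definition entropy : \bar R :=
  (- \int[mu]_(z in [set z | f z != 0%R]) (f z * ln (f z))%:E)%E.

Definition finite_entropy :=
  mu.-integrable [set z | f z != 0] (fun z => (f z * ln (f z))%:E).

End entropy.

(* [f] is the joint density of (Y, X) and [fX] the density of X, so that
   [f yx / fX yx.2] is the conditional density of Y given X.  The points where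
   [fX] vanishes but [f] does not, at which this quotient is the junk value 0,
   form a null set. *)
Section conditional_entropy.
Context d1 d2 (E1 : measurableType d1) (E2 : measurableType d2) (R : realType).
Variables (mu : {measure set (E1 * E2) -> \bar R}).
Variables (f : E1 * E2 -> R) (fX : E2 -> R).

Definition conditional_density (yx : E1 * E2) : R := f yx / fX yx.2.

Definition conditional_entropy : \bar R :=
  (- \int[mu]_(yx in [set yx | f yx != 0%R])
       (f yx * ln (conditional_density yx))%:E)%E.

Definition finite_conditional_entropy :=
  mu.-integrable [set yx | f yx != 0]
    (fun yx => (f yx * ln (conditional_density yx))%:E).

End conditional_entropy.

Section log_derivative.
Variables (R : realType) (d : nat).

Definition partial (g : 'rV[R]_d -> R) (i : 'I_d) (x : 'rV[R]_d) : R :=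
  'D_(delta_mx ord0 i) g x.

(* [lne 0 = -oo], whereas [ln 0 = 0] on reals: where the partial derivative
   vanishes its logarithm must count as -oo. *)
Definition log_partial (g : 'rV[R]_d -> R) (i : 'I_d) (x : 'rV[R]_d) : \bar R :=
  lne `|partial g i x|%:E.

Definition expected_log_derivative (g : 'rV[R]_d -> R) (fX : 'rV[R]_d -> R)
    (i : 'I_d) : \bar R :=
  (\int[@lebesgue_rV R d]_x (log_partial g i x * (fX x)%:E))%E.

Definition finite_expected_log_derivative (g : 'rV[R]_d -> R)
    (fX : 'rV[R]_d -> R) (i : 'I_d) :=
  (@lebesgue_rV R d).-integrable setT
    (fun x => (log_partial g i x * (fX x)%:E)%E).

End log_derivative.

(* Main.v *)
(* Write x = (x_i, z) with z = x_{~i}, and let f_Y be the joint density of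
   (Y, X_{~i}).  The core is the pointwise bound
     f_X(x) <= |dg/dx_i (x)| f_Y(g(x), z)   for almost every x.
   For almost every z, the map g(., z) pushes f_X(., z) dx_i to f_Y(., z) dy, and
   at Lebesgue points of both densities the bound follows by comparing averages:
   g(., z) sends the ball of radius r about x_i into the ball of radius
   (|dg/dx_i| + e) r about g(x).  Points that g(., z) sends to non-Lebesgue
   points of f_Y(., z) carry no mass.  The theorem is then Gibbs' inequality:
     E[ln (f_Xi f_X~i / (|dg/dx_i| f_Y))] <= E[ln (f_Xi f_X~i / f_X)]
       <= E[f_Xi f_X~i / f_X] - 1 <= 0. *)

From HB Require Import structures.
Require Import Defs.
From mathcomp Require Import all_boot all_order all_algebra.
From mathcomp Require Import all_classical all_reals all_analysis.
From mathcomp Require Import measurable_realfun lra.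
Import Order.TTheory GRing.Theory Num.Theory.
Import numFieldNormedType.Exports.

Set Implicit Arguments.
Unset Strict Implicit.
Unset Printing Implicit Defensive.

Local Open Scope classical_set_scope.
Local Open Scope ring_scope.

(** * Measurability of continuous functions on row vectors *)

Section measurable_rV_functions.
Context {R : realType} {n : nat}.
Implicit Types (g : 'rV[R]_n -> R).

(** The map [node k \o grid k] rounds every coordinate down to a multiple of 1/(k+1). It has
    countably many values, each taken on a measurable cell, so any function composed with it is
    measurable; continuity of [g] recovers [g] as the pointwise limit. *)
Let grid k (x : 'rV[R]_n) : 'rV[int]_n := \row_j Num.floor (x ord0 j * k.+1%:R).
Let node k (v : 'rV[int]_n) : 'rV[R]_n := \row_j ((v ord0 j)%:~R / k.+1%:R).

Let measurable_grid k v : measurable (grid k @^-1` [set v]).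
Proof.
rewrite [X in measurable X](_ : _ = \bigcap_(j in [set: 'I_n])
    ((fun x : 'rV[R]_n => x ord0 j) @^-1`
      `[(v ord0 j)%:~R / k.+1%:R, (v ord0 j + 1)%:~R / k.+1%:R[)).
  apply: fin_bigcap_measurable => // j _.
  by rewrite -[X in measurable X]setTI; exact: measurable_coord.
apply/seteqP; split=> [x /= <- j _ /=|x xv].
  by rewrite in_itv/= mxE ler_pdivrMr// ltr_pdivlMr// floor_itv.
apply/rowP => j; rewrite mxE; apply/floor_def.
by have /= := xv j I; rewrite in_itv/= ler_pdivrMr// ltr_pdivlMr.
Qed.

Let cvg_grid x : (node k (grid k x)) @[k --> \oo] --> x.
Proof.
apply/cvg_ballP => e e0; near=> k; split=> // i j; rewrite ord1 {i} !mxE.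
have k0 : 0 < k.+1%:R :> R by [].
have /andP[fl fr] := floor_itv (x ord0 j * k.+1%:R).
rewrite /ball/= ger0_norm ?subr_ge0 ?ler_pdivrMr//.
rewrite ltrBlDr -(ltr_pM2r k0) mulrDl divfK ?gt_eqF//.
rewrite (lt_le_trans fr)// intrD addrC lerD2r -ler_pdivrMr// mul1r ltW//.
by near: k; exact: (near_infty_natSinv_lt (PosNum e0)).
Unshelve. all: by end_near. Qed.

Lemma continuous_rV_measurable_fun g : continuous g -> measurable_fun setT g.
Proof.
move=> cg; apply: (@measurable_fun_cvg _ _ _ setT (fun k => g \o node k \o grid k)).
  move=> k _ B mB; rewrite setTI.
  rewrite [X in measurable X](_ : _ = \bigcup_(v : 'rV[int]_n)
      (if `[< B (g (node k v)) >] then grid k @^-1` [set v] else set0)).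
    by apply: countable_bigcupT_measurable => // v; case: ifPn.
  apply/seteqP; split=> [x Bx|x [v _]].
    by exists (grid k x) => //; case: asboolP.
  by case: asboolP => // Bv gx; rewrite /= gx.
by move=> x _; exact: (cvg_comp _ _ (@cvg_grid x) (cg x)).
Qed.

End measurable_rV_functions.

(** A directional derivative is the pointwise limit of the difference quotients with increments
    1/(k+1), each of which is continuous. *)
Lemma measurable_derive_rV (R : realType) n (g : 'rV[R]_n -> R) v :
  (forall x, differentiable g x) -> measurable_fun setT ('D_v g).
Proof.
move=> dg; have cg : continuous g by move=> x; exact: differentiable_continuous.
pose q k x := k.+1%:R * (g (x + k.+1%:R^-1 *: v) - g x).
apply: (@measurable_fun_cvg _ _ _ setT q).
  move=> k; apply: measurable_funM => //; apply: measurable_funB; last first.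
    exact: continuous_rV_measurable_fun.
  apply: continuous_rV_measurable_fun => x.
  apply: (@cvg_comp _ _ _ (fun x => x + k.+1%:R^-1 *: v) g _ _ _ _ (cg (x + k.+1%:R^-1 *: v))).
  apply: (@cvgD _ _ _ (nbhs x) _ id (cst _) x _) => //; exact: cvg_cst.
move=> x _; have dxv := @diff_derivable _ _ _ g x v (dg x).
have qx := (cvgr_dnbhsP _ _ _).1 dxv (fun k => k.+1%:R^-1).
rewrite (_ : q ^~ x = fun k => k.+1%:R^-1^-1 *: ((g \o shift x) (k.+1%:R^-1 *: v) - g x)).
  by apply: qx; split; [move=> k; rewrite invr_eq0|exact: cvg_harmonic].
by apply/funext => k; rewrite /q invrK /= [_ *: v + x]addrC.
Qed.

(** * Lebesgue measure and coordinate insertion *)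

Section insert_coordinate.
Context {R : realType} {n : nat} (i : 'I_n.+1).

(** Inverse of the splitting of x into x_i and x_{~i}: [unlift i j] is [None] exactly at [j = i],
    where [oapp] falls back to the inserted value. *)
Definition insrV (p : measurableTypeR R * 'rV[R]_n) : 'rV[R]_n.+1 :=
  \row_j oapp (p.2 ord0) p.1 (unlift i j).

Lemma insrV_coord p : insrV p ord0 i = p.1.
Proof. by rewrite mxE unlift_none. Qed.

Lemma insrV_lift p j : insrV p ord0 (lift i j) = p.2 ord0 j.
Proof. by rewrite mxE liftK. Qed.

Lemma col'_insrV p : col' i (insrV p) = p.2.
Proof. by apply/rowP => j; rewrite mxE insrV_lift. Qed.

Lemma insrVK (x : 'rV[R]_n.+1) : insrV (x ord0 i, col' i x) = x.
Proof.
apply/rowP => j; case: (unliftP i j) => [k|] ->.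
  by rewrite insrV_lift mxE.
by rewrite insrV_coord.
Qed.

Lemma measurable_insrV : measurable_fun setT insrV.
Proof.
apply: measurable_fun_rVP => j; case: (unliftP i j) => [k|] ->.
  under eq_fun do rewrite insrV_lift.
  by apply: (measurableT_comp (measurable_coord k)); exact: measurable_snd.
under eq_fun do rewrite insrV_coord.
exact: measurable_fst.
Qed.

Lemma measurable_col' : measurable_fun setT (fun x : 'rV[R]_n.+1 => col' i x : 'rV[R]_n).
Proof.
apply: measurable_fun_rVP => j; under eq_fun do rewrite mxE.
exact: measurable_coord.
Qed.

Lemma measurable_box m (A : 'I_m -> set R) : (forall j, measurable (A j)) ->
  measurable [set v : 'rV[R]_m | forall j, A j (v ord0 j)].
Proof.
move=> mA; rewrite [X in measurable X](_ : _ = \bigcap_(j in [set: 'I_m])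
      ((fun v : 'rV[R]_m => v ord0 j) @^-1` A j)).
  apply: fin_bigcap_measurable => // j _.
  by rewrite -[X in measurable X]setTI; exact: measurable_coord.
by apply/seteqP; split=> v /= h j; [move=> _|]; exact: h.
Qed.

Let boxes : set (set 'rV[R]_n.+1) :=
  [set B | exists2 A : 'I_n.+1 -> set R, (forall j, measurable (A j)) &
     B = [set v : 'rV[R]_n.+1 | forall j, A j (v ord0 j)]].

Let measurable_boxes : measurable = <<s boxes >>.
Proof.
apply/seteqP; split => B; last first.
  apply: smallest_sub; first exact: sigma_algebra_measurable.
  by move=> _ [A mA ->]; exact: measurable_box.
move=> mB.
have : <<s \big[setU/set0]_(i < n.+1) preimage_set_system setT
   (fun x : 'rV[R]_n.+1 => x ord0 i) measurable >> B by exact: mB.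
rewrite -bigcup_seq; move: B {mB}; apply: smallest_sub; first exact: smallest_sigma_algebra.
move=> A [j _] [C mC <-] /=; rewrite setTI; apply: sub_sigma_algebra.
exists (fun k => if k == j then C else setT); first by move=> k; case: ifPn.
apply/seteqP; split=> v /= => [Cv k|/(_ j)]; last by rewrite eqxx.
by case: eqP => // ->.
Qed.

(** [lebesgue_rV] is built by inserting at coordinate 0, whereas here an arbitrary coordinate [i] is
    split off. Both measures agree on boxes, a generating family closed under intersection, and
    cubes of finite measure exhaust the space. *)
Lemma lebesgue_rV_insrV A : measurable A ->
  lebesgue_rV R n.+1 A = (@lebesgue_measure R \x lebesgue_rV R n)%E (insrV @^-1` A).
Proof.
move=> mA.
apply: (measure_unique boxes
  (fun k => [set v : 'rV[R]_n.+1 | forall j, `[- k%:R, k%:R]%classic (v ord0 j)])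
  measurable_boxes _ _ _ (lebesgue_rV R n.+1)
  (pushforward (@lebesgue_measure R \x lebesgue_rV R n)%E insrV)) => //.
- move=> _ _ [A1 mA1 ->] [A2 mA2 ->]; exists (fun j => A1 j `&` A2 j).
    by move=> j; exact: measurableI.
  apply/seteqP; split=> v /=; first by move=> [h1 h2] j; split.
  by move=> h; split=> j; have [] := h j.
- by move=> k; exists (fun=> `[- k%:R, k%:R]%classic).
- apply/seteqP; split=> // v _.
  (* The sum of the absolute values dominates every coordinate, so it gives the index of a cube
     containing [v]. *)
  exists (Num.truncn (\sum_j `|v ord0 j|)).+1 => // j /=.
  rewrite in_itv/= -ler_norml (le_trans _ (ltW (truncnS_gt _)))//.
  by rewrite (bigD1 j)//= lerDl sumr_ge0.
- exact: measurable_insrV.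
- move=> mins _ [B mB ->]; rewrite [LHS](lebesgue_rV_box mB) (bigD1_ord i)//=.
  rewrite -[X in (_ * X)%E](lebesgue_rV_box (fun j => mB (lift i j))) /pushforward.
  rewrite -(product_measure1E (lebesgue_measure : {sigma_finite_measure set _ -> \bar R}))//.
  + congr (_ _); apply/seteqP; split=> -[x v] /=.
      move=> [hx hv] j; case: (unliftP i j) => [k|] ->.
        by rewrite insrV_lift; exact: hv.
      by rewrite insrV_coord.
    move=> h; split; first by have := h i; rewrite insrV_coord.
    by move=> j; have := h (lift i j); rewrite insrV_lift.
  + exact: mB.
  + exact: (@measurable_box n (fun j => B (lift i j)) (fun j => mB (lift i j))).
- move=> k.
  have mI (j : 'I_n.+1) : measurable (`[- k%:R, k%:R]%classic : set R) by [].
  rewrite [X in (X < _)%E](lebesgue_rV_box mI) -ge0_fin_numE; last exact: prode_ge0.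
  elim/big_ind : _ => //= [x y|j _]; first exact: fin_numM.
  by rewrite lebesgue_measure_itv/=; case: ifPn.
Qed.

End insert_coordinate.

(** * Densities *)

Section density_measure.
Context d (E : measurableType d) (R : realType).
Variables (mu : {measure set E -> \bar R}) (f : E -> R).
Local Open Scope ereal_scope.

Definition density_measure (A : set E) : \bar R := \int[mu]_(x in A) (f x)%:E.

Hypotheses (mf : measurable_fun setT f) (f0 : forall x, (0 <= f x)%R).

Let density_measure0 : density_measure set0 = 0.
Proof. exact: integral_set0. Qed.

Let density_measure_ge0 A : 0 <= density_measure A.
Proof. by apply: integral_ge0 => x _; rewrite lee_fin. Qed.

Let density_measure_sigma_additive : semi_sigma_additive density_measure.
Proof.
apply: (@semi_sigma_additive_nng_induced _ _ _ _ (EFin \o f)).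
  exact/measurable_EFinP.
by move=> x; rewrite lee_fin.
Qed.

HB.instance Definition _ := isMeasure.Build _ _ _ density_measure
  density_measure0 density_measure_ge0 density_measure_sigma_additive.

(** Names the measure structure with [mf] and [f0] as arguments, so that it can be instantiated on
    each fibre. *)
Definition density_measure_of : {measure set E -> \bar R} := density_measure.

Import HBNNSimple.

(** By monotone convergence both sides are limits of their values on the simple functions [h n], for
    which the identity is the definition of [density_measure] on the level sets. *)
Lemma ge0_integral_density_measure (phi : E -> \bar R) :
  measurable_fun setT phi -> (forall x, 0 <= phi x) ->
  \int[density_measure]_x phi x = \int[mu]_x (phi x * (f x)%:E).
Proof.
move=> mphi phi0; pose h := nnsfun_approx measurableT mphi.
have cvgh x : (h n x)%:E @[n --> \oo] --> phi x by exact: cvg_nnsfun_approx.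
have mfE : measurable_fun setT (EFin \o f) by exact/measurable_EFinP.
have mh n : measurable_fun setT (EFin \o h n) by exact/measurable_EFinP.
have ndh x : {homo (fun n => (h n x)%:E) : m n / (m <= n)%N >-> m <= n}.
  by move=> m n mn; rewrite lee_fin; exact/lefP/nd_nnsfun_approx.
transitivity (limn (fun n => \int[density_measure]_x (h n x)%:E)).
  rewrite -monotone_convergence//.
  - by apply: eq_integral => x _; apply/esym/cvg_lim => //; exact: cvgh.
  - by move=> n x _; rewrite lee_fin.
transitivity (limn (fun n => \int[mu]_x ((h n x)%:E * (f x)%:E))); last first.
  rewrite -monotone_convergence//.
  - apply: eq_integral => x _; apply/cvg_lim => //.
    by apply: cvgeZr => //; exact: cvgh.
  - by move=> n; exact: (emeasurable_funM (mh n) mfE).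
  - by move=> n x _; rewrite mule_ge0 ?lee_fin.
  - by move=> x _ m n mn; rewrite lee_wpmul2r ?lee_fin//; exact: ndh.
congr (limn _); apply/funext => n.
transitivity (\sum_(k \in range (h n))
    \int[mu]_x ((k * \1_(h n @^-1` [set k]) x)%:E * (f x)%:E)).
  under eq_integral do rewrite fimfunE -fsumEFin//.
  rewrite ge0_integral_fsum//; last 2 first.
  - by move=> y; exact/measurable_EFinP/measurable_funM.
  - by move=> y x _; rewrite nnfun_muleindic_ge0.
  apply: eq_fsbigr => r /[1!inE] -[x0 _ <-].
  rewrite integralZl_indic_nnsfun// integral_indic//= setIT.
  rewrite /density_measure [in LHS]integral_mkcond -ge0_integralZl//.
  - apply: eq_integral => x _; rewrite patchE EFinM -muleA indicE.
    by case: ifPn => xA; rewrite ?mul1e ?mul0e.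
  - by apply/(measurable_restrictT _ _).1; [exact: measurable_funPTI|exact: measurable_funTS].
  - by move=> x _; rewrite patchE; case: ifPn => // _; rewrite lee_fin.
  - by rewrite lee_fin.
rewrite -ge0_integral_fsum//.
- apply: eq_integral => x _; rewrite [in RHS]fimfunE -fsumEFin// ge0_mule_fsuml//.
  by move=> r; rewrite nnfun_muleindic_ge0.
- by move=> r; apply: emeasurable_funM => //; exact/measurable_EFinP/measurable_funM.
- by move=> r x _; apply: mule_ge0; [exact: nnfun_muleindic_ge0|rewrite lee_fin].
Qed.

End density_measure.

(** * Integrals over the support of a density *)

Section integral_support.
Context d (E : measurableType d) (R : realType).
Variables (mu : {measure set E -> \bar R}) (f phi : E -> R).

(** The factor [f z] already kills the integrand off the support, so entropies can be computed over
    the whole space. *)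
Lemma patch_support : (fun z => (f z * phi z)%:E) \_ [set z | f z != 0%R] =
  (fun z => (f z * phi z)%:E).
Proof.
apply/funext => z; rewrite patchE; case: ifPn => //.
by rewrite notin_setE/= => /negP; rewrite negbK => /eqP ->; rewrite mul0r.
Qed.

Lemma integrable_support : measurable_fun setT f ->
  mu.-integrable [set z | f z != 0%R] (fun z => (f z * phi z)%:E) <->
  mu.-integrable setT (fun z => (f z * phi z)%:E).
Proof.
move=> mf; have mS : measurable [set z | f z != 0%R].
  rewrite (_ : [set z | _] = f @^-1` (~` [set 0])); last first.
    by apply/seteqP; split => z /= /eqP.
  by rewrite -[X in measurable X]setTI; apply: mf => //; exact: measurableC.
by split=> [/(integrable_mkcond _ mS)|h]; [|apply/(integrable_mkcond _ mS)];
  rewrite patch_support.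
Qed.

Lemma integral_support :
  (\int[mu]_(z in [set z | f z != 0%R]) (f z * phi z)%:E =
   \int[mu]_z (f z * phi z)%:E)%E.
Proof. by rewrite integral_mkcond patch_support. Qed.

End integral_support.

(** * Expectations computed from a density *)

Section is_density_theory.
Context d1 d2 (T : measurableType d1) (E : measurableType d2) (R : realType).
Variables (P : probability T R) (mu : {measure set E -> \bar R}).
Variables (Z : T -> E) (f : E -> R).
Hypotheses (mZ : measurable_fun setT Z) (Zf : is_density P mu Z f).
Local Open Scope ereal_scope.

Lemma ge0_integral_is_density (phi : E -> \bar R) :
  measurable_fun setT phi -> (forall x, 0 <= phi x) ->
  \int[P]_w phi (Z w) = \int[mu]_z (phi z * (f z)%:E).
Proof.
case: Zf => mf f0 Pf mphi phi0.
rewrite -(ge0_integral_density_measure mu mf f0 mphi phi0).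
transitivity (\int[pushforward P Z]_z phi z).
  by rewrite ge0_integral_pushforward.
by apply: eq_measure_integral => // A mA _; exact: Pf.
Qed.

(** The law of [Z] is absolutely continuous with respect to [mu]. *)
Lemma is_density_ae (Q : set E) : {ae mu, forall z, Q z} -> {ae P, forall w, Q (Z w)}.
Proof.
case: Zf => mf f0 Pf [N [mN N0 QN]]; exists (Z @^-1` N); split.
- by rewrite -[X in measurable X]setTI; exact: mZ.
- rewrite [LHS]Pf// null_set_integral//.
  by apply: measurable_funTS; exact/measurable_EFinP.
- by move=> w /= nQ; exact: QN.
Qed.

Lemma is_density_neq0 : {ae P, forall w, f (Z w) != 0%R}.
Proof.
case: Zf => mf f0 Pf; exists (Z @^-1` (f @^-1` [set 0%R])); split.
- rewrite -[X in measurable X]setTI; apply: mZ => //.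
  by rewrite -[X in measurable X]setTI; exact: mf.
- rewrite [LHS]Pf//; last by rewrite -[X in measurable X]setTI; exact: mf.
  by rewrite integral0_eq// => z /= ->.
- by move=> w /= /negP; rewrite negbK => /eqP.
Qed.

Lemma is_density_integral1 : \int[mu]_z (f z)%:E = 1.
Proof. by case: Zf => mf f0 <-//; rewrite /pushforward preimage_setT probability_setT. Qed.

Lemma is_density_integrable : mu.-integrable setT (EFin \o f).
Proof.
case: (Zf) => mf f0 _; apply/integrableP; split; first exact/measurable_EFinP.
under eq_integral do rewrite /= ger0_norm//.
by rewrite is_density_integral1 ltry.
Qed.

Section real_test_function.
Variable phi : E -> R.
Hypotheses (mphi : measurable_fun setT phi).
Hypothesis iphi : mu.-integrable [set z | f z != 0%R] (fun z => (f z * phi z)%:E).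

Let iphiT : mu.-integrable setT (fun z => (f z * phi z)%:E).
Proof. by have [mf _ _] := Zf; exact/integrable_support. Qed.

Lemma integrable_is_density : P.-integrable setT (fun w => (phi (Z w))%:E).
Proof.
have [mf f0 Pf] := Zf.
apply/integrableP; split; first exact/measurable_EFinP/measurableT_comp.
rewrite (ge0_integral_is_density (phi := fun z => `|(phi z)%:E|))//; last first.
  by apply/measurable_EFinP; exact: measurableT_comp.
have /integrableP[_] := iphiT; congr (_ < _).
by apply: eq_integral => z _; rewrite /= normrM (ger0_norm (f0 z)) mulrC EFinM.
Qed.

Lemma integral_is_density :
  \int[P]_w (phi (Z w))%:E =
  \int[mu]_(z in [set z | f z != 0%R]) (f z * phi z)%:E.
Proof.
have [mf f0 Pf] := Zf.
have mphiE : measurable_fun setT (EFin \o phi) by exact/measurable_EFinP.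
rewrite integral_support.
(* Positive and negative parts are treated separately; since [f] is nonnegative, it can be moved
   inside the maximum. *)
rewrite [LHS]integralE [RHS]integralE; congr (_ - _).
  rewrite (eq_integral (fun w => (EFin \o phi)^\+ (Z w))); last first.
    by move=> w _; rewrite !funeposE.
  rewrite ge0_integral_is_density//; last exact: measurable_funepos.
  apply: eq_integral => z _; rewrite !funeposE/= -!EFin_max -EFinM.
  by rewrite maxr_pMl// mul0r mulrC.
rewrite (eq_integral (fun w => (EFin \o phi)^\- (Z w))); last first.
  by move=> w _; rewrite !funenegE.
rewrite ge0_integral_is_density//; last exact: measurable_funeneg.
apply: eq_integral => z _; rewrite !funenegE/= -!EFin_max -EFinM.
by rewrite maxr_pMl// mul0r mulNr mulrC.
Qed.

End real_test_function.
End is_density_theory.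

(** * Densities of differentiable images *)

Section pushforward_density_derivative.
Context {R : realType}.
Local Notation mu := (@lebesgue_measure R).
Implicit Types f k h : R -> R.

(** Serves with factor 1 about [x] and with a factor above the modulus of the derivative about
    [h x], so that the two sequences of balls have proportional radii. *)
Lemma nicely_shrinking_ball (c : R) : 0 < c ->
  forall x, nicely_shrinking x (fun n => ball x (c * n.+1%:R^-1)).
Proof.
move=> c0 x; split; first by move=> n; exact: measurable_ball.
have r0 n : 0 < c * n.+1%:R^-1 by rewrite mulr_gt0.
exists (1, fun n => PosNum (r0 n)); split => //= [|n|n]; [|exact: subset_refl|by rewrite mul1e].
rewrite -[X in _ --> X](mulr0 c); apply: cvgM; [exact: cvg_cst|exact: cvg_harmonic].
Qed.

(** Only pairs containing [x] are compared: the difference quotients at [x] converge to ['D_1 h x],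
    so their moduli are eventually below [c]. *)
Lemma derivable_locally_lipschitz h x c : derivable h x 1 -> `|'D_1 h x| < c ->
  \forall r \near 0^'+, forall y, ball x r y -> ball (h x) (c * r) (h y).
Proof.
move=> dh hc; have : \forall t \near 0^', `|t^-1 *: (h (t *: 1 + x) - h x)| < c.
  have dhx : t^-1 *: ((h \o shift x) (t *: 1) - h x) @[t --> 0^'] --> 'D_1 h x by exact: dh.
  exact: (cvgr_norm_lt _ dhx _ hc).
move=> [d /= d0 dH]; near=> r => y.
have r0 : 0 < r by [].
have [->|yx xry] := eqVneq y x.
  by move=> _; apply: ballxx; rewrite mulr_gt0// (le_lt_trans _ hc).
have := dH (y - x).
rewrite /= sub0r normrN subr_eq0 => /(_ _ yx).
move: xry; rewrite /ball/= distrC => yxr.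
have yxd : `|y - x| < d by rewrite (lt_trans yxr).
move/(_ yxd); rewrite normrZ normrV ?unitfE ?subr_eq0// ltr_pdivrMl ?normr_gt0 ?subr_eq0//.
rewrite [_ *: 1]mulr1 subrK [`|h x - _|]distrC => /lt_trans; apply.
by rewrite mulrC ltr_pM2l// (le_lt_trans _ hc).
Unshelve. all: by end_near. Qed.

(** For [c] above the modulus of the derivative, a small ball of radius r about [x] lies in the
    preimage of the ball of radius c r about [h x], so [f] has at most as much mass on the former as
    [k] on the latter. Dividing by 2r and letting r tend to 0 gives [f x <= c * k (h x)]. *)
Lemma le_lebesgue_pt_density f k h x :
  mu.-integrable setT (EFin \o f) -> mu.-integrable setT (EFin \o k) ->
  (forall y, 0 <= f y) -> (forall y, 0 <= k y) ->
  measurable_fun setT h ->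
  (forall B, measurable B ->
    (\int[mu]_(y in h @^-1` B) (f y)%:E = \int[mu]_(y in B) (k y)%:E)%E) ->
  derivable h x 1 -> lebesgue_pt f x -> lebesgue_pt k (h x) ->
  f x <= `|'D_1 h x| * k (h x).
Proof.
move=> intf intk f0 k0 mh hfk dh fx kx.
have mf : measurable_fun setT (EFin \o f) := measurable_int _ intf.
have mk : measurable_fun setT (EFin \o k) := measurable_int _ intk.
have locf := open_integrable_locally openT intf.
have lock := open_integrable_locally openT intk.
suff H c : `|'D_1 h x| < c -> f x <= c * k (h x).
  apply/ler_addgt0Pr => e e0.
  have k1 : 0 < k (h x) + 1 by rewrite ltr_wpDl.
  (* Multiplied by [k (h x)], this increment costs at most [e]; the added 1 keeps the denominator
     positive. *)
  have := H (`|'D_1 h x| + e / (k (h x) + 1)).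
  rewrite ltrDl divr_gt0// => /(_ isT)/le_trans; apply.
  rewrite mulrDl lerD2l mulrAC ler_pdivrMr// ler_pM2l// lerDl//.
move=> hc; have c0 : 0 < c by rewrite (le_lt_trans _ hc).
have cvgf := nice_lebesgue_differentiation (nicely_shrinking_ball ltr01) locf fx.
have cvgk := nice_lebesgue_differentiation (nicely_shrinking_ball c0) lock kx.
rewrite -lee_fin EFinM.
have {}cvgk := cvgeZl (y := c%:E) isT cvgk.
have [d /= d0 hd] := derivable_locally_lipschitz dh hc.
apply: (lee_cvg_to cvgf cvgk).
near=> n.
have rn0 : 0 < n.+1%:R^-1 :> R by [].
have crn0 : 0 < c * n.+1%:R^-1 by rewrite mulr_gt0.
rewrite mul1r (lebesgue_measure_ball _ (ltW rn0)) (lebesgue_measure_ball _ (ltW crn0)).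
rewrite !inver !mulrn_eq0/= !gt_eqF ?mulr_gt0//.
(* The factor [c] cancels against the larger radius in the average of [k], leaving 1/(2r) on both
   sides. *)
rewrite muleA -EFinM -!mulrnAr invfM mulVKf ?gt_eqF//.
rewrite lee_pmul2l ?lte_fin ?invr_gt0 ?mulrn_wgt0//.
rewrite -hfk; last exact: measurable_ball.
apply: ge0_subset_integral.
- exact: measurable_ball.
- rewrite -[X in measurable X]setTI; apply: mh => //; exact: measurable_ball.
- exact: measurable_funTS.
- by move=> y _; rewrite lee_fin.
move=> y; apply: (hd n.+1%:R^-1) => //=.
rewrite sub0r normrN gtr0_norm//.
by near: n; exact: (near_infty_natSinv_lt (PosNum d0)).
Unshelve. all: by end_near. Qed.

Lemma pushforward_density_le f k h :
  mu.-integrable setT (EFin \o f) -> mu.-integrable setT (EFin \o k) ->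
  (forall y, 0 <= f y) -> (forall y, 0 <= k y) ->
  (forall x, derivable h x 1) ->
  (forall B, measurable B ->
    (\int[mu]_(y in h @^-1` B) (f y)%:E = \int[mu]_(y in B) (k y)%:E)%E) ->
  {ae mu, forall x, f x <= `|'D_1 h x| * k (h x)}.
Proof.
move=> intf intk f0 k0 dh hfk.
have mf : measurable_fun setT (EFin \o f) := measurable_int _ intf.
have mk : measurable_fun setT (EFin \o k) := measurable_int _ intk.
have mh : measurable_fun setT h.
  apply: continuous_measurable_fun => x.
  exact/differentiable_continuous/derivable1_diffP.
have [N [mN N0 kN]] := lebesgue_differentiation (open_integrable_locally openT intk).
have mhN : measurable (h @^-1` N).
  by rewrite -[X in measurable X]setTI; exact: mh.
(* The null set [N] covers the non-Lebesgue points of [k]. By [hfk] the mass of [f] on its preimage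
   is the integral of [k] over [N], that is 0, so there [f] vanishes almost everywhere and the bound
   is trivial. *)
have fN : ae_eq mu (h @^-1` N) (EFin \o f) (cst 0%E).
  apply/ae_eq_integral_abs => //; first exact: measurable_funTS.
  under eq_integral do rewrite /= ger0_norm//.
  rewrite hfk// null_set_integral//; exact: measurable_funTS.
have FF := ae_filter_ringOfSetsType mu.
have fpt := lebesgue_differentiation (open_integrable_locally openT intf).
apply: (filterS2 _ _ fpt fN) => x fx hxN.
have [hNx|hNx] := pselect (N (h x)).
  by have [->] := hxN hNx; rewrite mulr_ge0.
apply: le_lebesgue_pt_density => //.
by apply: contrapT => /kN.
Qed.

End pushforward_density_derivative.

(** * Finite measures on the line are determined by rational rays *)

Section ray_uniqueness.
Context {R : realType}.

(** The point is countability: identities holding almost everywhere for each single ray hold for all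
    rays outside one null set. *)
Definition rational_rays : set (set R) :=
  [set `](ratr q : R), +oo[%classic | q in [set: rat]].

Lemma measurable_rational_rays : measurable = <<s rational_rays >>.
Proof.
apply/seteqP; split => A; last first.
  apply: smallest_sub; first exact: sigma_algebra_measurable.
  by move=> _ [q _ <-]; exact: measurable_itv.
move=> mA; have : <<s @RGenOInfty.G R >> A.
  by have := RGenOInfty.measurableE R; rewrite /measurable/= => <-.
move: A {mA}; apply: smallest_sub; first exact: smallest_sigma_algebra.
move=> _ [x ->].
(* A real ray is the union of the rational rays inside it, indexed by all of [rat] with the empty
   set for the other indices. *)
have -> : `]x, +oo[%classic = \bigcup_(q in [set: rat])
    (if x < ratr q then `](ratr q : R), +oo[%classic else set0); last first.
  pose G := g_sigma_algebraType rational_rays.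
  apply: (@countable_bigcupT_measurable _ G) => // q.
  case: ifPn => _; last exact: measurable0.
  by apply: sub_sigma_algebra; exists q.
apply/seteqP; split => y /=; rewrite ?in_itv/= ?andbT.
  move=> /rat_in_itvoo[q]; rewrite in_itv/= => /andP[xq qy].
  by exists q => //; rewrite xq/= in_itv/= qy.
by move=> [q _]; case: ifPn => // xq; rewrite /= in_itv/= andbT; exact: lt_trans.
Qed.

Lemma finite_measure_unique_rays (m1 m2 : {measure set (measurableTypeR R) -> \bar R}) :
  (m1 setT < +oo)%E ->
  (forall q : rat, m1 `]ratr q, +oo[%classic = m2 `]ratr q, +oo[%classic) ->
  forall A, measurable A -> m1 A = m2 A.
Proof.
move=> m1oo m12.
apply: (@measure_unique _ R (measurableTypeR R) rational_rays
  (fun k => `]ratr (- k%:R), +oo[%classic)).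
- exact: measurable_rational_rays.
- move=> _ _ [p _ <-] [q _ <-]; exists (Num.max p q) => //.
  apply/seteqP; split => x /=; rewrite !in_itv/= !andbT.
    have [pq|pq] := leP p q.
      by move=> qx; split=> //; rewrite (le_lt_trans _ qx)// ler_rat.
    by move=> px; split=> //; rewrite (lt_trans _ px)// ltr_rat.
  by move=> [px qx]; have [pq|pq] := leP p q.
- by move=> k; exists (- k%:R).
- apply/seteqP; split=> // x _; exists (Num.truncn `|x|).+1 => //=.
  rewrite in_itv/= andbT rmorphN/= ratr_nat ltrNl (le_lt_trans _ (truncnS_gt _))//.
  by rewrite -normrN ler_norm.
- by move=> _ [q _ <-].
- move=> k; rewrite (le_lt_trans _ m1oo)// le_measure ?inE//.
Qed.

End ray_uniqueness.

(** * From a pushforward identity on a product to its fibres *)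

Section fibre_pushforward.
Context {R : realType} d1 d2 d3 (T1 : measurableType d1) (T2 : measurableType d2)
  (S : measurableType d3).
Variables (m1 : {sigma_finite_measure set T1 -> \bar R})
  (m2 : {sigma_finite_measure set T2 -> \bar R})
  (m : {sigma_finite_measure set S -> \bar R}).
Variables (f : T1 * S -> R) (k : T2 * S -> R) (G : T1 * S -> T2).
Hypotheses (intf : (m1 \x m)%E.-integrable setT (EFin \o f))
  (intk : (m2 \x m)%E.-integrable setT (EFin \o k)).
Hypotheses (f0 : forall p, 0 <= f p) (k0 : forall p, 0 <= k p).
Hypothesis mG : measurable_fun setT G.
Hypothesis fGk : forall A, measurable A ->
  (\int[m1 \x m]_(p in (fun p => (G p, p.2)) @^-1` A) (f p)%:E =
   \int[m2 \x m]_(p in A) (k p)%:E)%E.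

Let mf : measurable_fun setT (EFin \o f) := measurable_int _ intf.
Let mk : measurable_fun setT (EFin \o k) := measurable_int _ intk.

(* The two sides, as functions of [z], have equal integrals over every
   measurable set. *)
Lemma ae_fibre_pushforward_set B : measurable B ->
  {ae m, forall z, (\int[m1]_(x in [set x | B (G (x, z))]) (f (x, z))%:E =
                    \int[m2]_(x in B) (k (x, z))%:E)%E}.
Proof.
move=> mB.
have mGB : measurable (G @^-1` B) by rewrite -[X in measurable X]setTI; exact: mG.
have mB1 : measurable (fst @^-1` B : set (T2 * S)).
  by rewrite -[X in measurable X]setTI; exact: measurable_fst.
pose fB := (EFin \o f) \_ (G @^-1` B); pose kB := (EFin \o k) \_ (fst @^-1` B).
have fE : (fun z => \int[m1]_(x in [set x | B (G (x, z))]) (f (x, z))%:E)%E =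
   fubini_G m1 fB.
  apply/funext => z; rewrite [LHS]integral_mkcond.
  by apply: eq_integral => x _; rewrite /fB !patchE.
have kE : (fun z => \int[m2]_(x in B) (k (x, z))%:E)%E = fubini_G m2 kB.
  apply/funext => z; rewrite [LHS]integral_mkcond.
  by apply: eq_integral => x _; rewrite /kB !patchE.
have fB0 p : (0 <= fB p)%E by rewrite /fB patchE; case: ifPn; rewrite ?lee_fin.
have kB0 p : (0 <= kB p)%E by rewrite /kB patchE; case: ifPn; rewrite ?lee_fin.
have mfB : measurable_fun setT fB.
  by apply/(measurable_restrictT _ _).1 => //; exact: measurable_funTS.
have mkB : measurable_fun setT kB.
  by apply/(measurable_restrictT _ _).1 => //; exact: measurable_funTS.
(* Tonelli's theorem localised to the fibres over [C]. *)
have integral_fibre d' (T : measurableType d') (n : {sigma_finite_measure set T -> \bar R})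
    (h : T * S -> \bar R) C : measurable_fun setT h -> (forall p, 0 <= h p)%E ->
    measurable C ->
    (\int[m]_(z in C) fubini_G n h z = \int[n \x m]_(p in snd @^-1` C) h p)%E.
  move=> mh h0 mC; rewrite integral_mkcond [RHS]integral_mkcond fubini_tonelli2.
  - apply: eq_integral => z _; rewrite /fubini_G patchE; case: ifPn => zC.
      by apply: eq_integral => x _; rewrite patchE ifT.
    rewrite integral0_eq// => x _; rewrite patchE ifF//.
    by apply/negbTE; move: zC; rewrite !notin_setE.
  - apply/(measurable_restrictT _ _).1; last exact: measurable_funTS.
    by rewrite -[X in measurable X]setTI; exact: measurable_snd.
  - by move=> p; rewrite patchE; case: ifPn.
have : ae_eq m setT (fubini_G m1 fB) (fubini_G m2 kB).
  apply: integral_ae_eq => //.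
  - apply/integrableP; split; first exact: measurable_fun_fubini_tonelli_G.
    rewrite (eq_integral (fubini_G m1 fB)); last first.
      by move=> z _; rewrite gee0_abs//; apply: integral_ge0.
    rewrite -fubini_tonelli2//.
    have /integrableP[_] := intf; apply: le_lt_trans.
    apply: ge0_le_integral => //; first exact: measurableT_comp.
    by move=> p _; rewrite /fB patchE; case: ifPn => _; [exact: lee_abs|exact: abse_ge0].
  - exact: measurable_fun_fubini_tonelli_G.
  move=> C _ mC; rewrite !integral_fibre//.
  rewrite /fB /kB -!integral_mkcondr.
  (* The map [(G p, p.2)] pulls the set with first coordinate in [B] and second in [C] back to the
     domain on the left. *)
  rewrite -fGk; last first.
    by apply: measurableI => //; rewrite -[X in measurable X]setTI; exact: measurable_snd.
  congr (integral _ _ _); apply/seteqP; split => p /=; tauto.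
apply: filterS => z /(_ I).
by rewrite -fE -kE.
Qed.

End fibre_pushforward.

Section fibre_pushforward_real.
Context {R : realType} d1 d3 (T1 : measurableType d1) (S : measurableType d3).
Variables (m1 : {sigma_finite_measure set T1 -> \bar R})
  (m2 : {sigma_finite_measure set (measurableTypeR R) -> \bar R})
  (m : {sigma_finite_measure set S -> \bar R}).
Variables (f : T1 * S -> R) (k : measurableTypeR R * S -> R)
  (G : T1 * S -> measurableTypeR R).
Hypotheses (intf : (m1 \x m)%E.-integrable setT (EFin \o f))
  (intk : (m2 \x m)%E.-integrable setT (EFin \o k)).
Hypotheses (f0 : forall p, 0 <= f p) (k0 : forall p, 0 <= k p).
Hypothesis mG : measurable_fun setT G.
Hypothesis fGk : forall A, measurable A ->
  (\int[m1 \x m]_(p in (fun p => (G p, p.2)) @^-1` A) (f p)%:E =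
   \int[m2 \x m]_(p in A) (k p)%:E)%E.

(** The null set must not depend on [B]. One null set is discarded per rational ray, and one more
    for the fibres where [f] is not integrable; on every other fibre both sides are measures of [B],
    the left one finite, that agree on rational rays. *)
Lemma ae_fibre_pushforward :
  {ae m, forall z B, measurable B ->
    (\int[m1]_(x in [set x | B (G (x, z))]) (f (x, z))%:E =
     \int[m2]_(x in B) (k (x, z))%:E)%E}.
Proof.
have FF := ae_filter_ringOfSetsType m.
have rays : {ae m, forall z (q : rat),
    (\int[m1]_(x in [set x | `](ratr q : R), +oo[%classic (G (x, z))]) (f (x, z))%:E =
     \int[m2]_(x in `]ratr q, +oo[) (k (x, z))%:E)%E}.
  (* Rationals are enumerated through [unpickle] since [ae_foralln] ranges over [nat]. The default 0
     is harmless: [pickle q] reaches every [q]. *)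
  have : {ae m, forall z (n : nat), let q := odflt 0 (unpickle n) in
      (\int[m1]_(x in [set x | `](ratr q : R), +oo[%classic (G (x, z))]) (f (x, z))%:E =
       \int[m2]_(x in `]ratr q, +oo[) (k (x, z))%:E)%E}.
    apply/ae_foralln => n /=.
    apply: (ae_fibre_pushforward_set intf intk f0 k0 mG fGk).
    exact: measurable_itv.
  apply: filterS => z zn q.
  by have := zn (pickle q); rewrite pickleK.
apply: (filterS2 _ _ rays (ae_integrable2 intf)) => z zq intfz B mB.
have mfz : measurable_fun setT (fun x => f (x, z)).
  by have := measurable_int _ intfz => /measurable_EFinP.
have mkz : measurable_fun setT (fun x => k (x, z)).
  have /measurable_EFinP mk := measurable_int _ intk.
  exact: measurableT_comp.
have mGz : measurable_fun setT (fun x => G (x, z)) by exact: measurableT_comp.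
pose nu1 := density_measure_of m1 mfz (fun x => f0 (x, z)).
pose nu2 := density_measure_of m2 mkz (fun x => k0 (x, z)).
suff : pushforward nu1 (fun x => G (x, z)) B = nu2 B by [].
apply: (@finite_measure_unique_rays R (pushforward nu1 (fun x => G (x, z))) nu2) => //.
suff : (\int[m1]_x (f (x, z))%:E < +oo)%E by [].
have /integrableP[_] := intfz; apply: le_lt_trans.
apply: ge0_le_integral => //=.
- by move=> x _; rewrite lee_fin.
- exact/measurable_EFinP.
- by apply/measurable_EFinP; exact: measurableT_comp.
- by move=> x _; rewrite lee_fin ler_norm.
Qed.

End fibre_pushforward_real.

(** * Null sets of a product measure *)

Section ae_product.
Context {R : realType} d1 d2 (T1 : measurableType d1) (T2 : measurableType d2).
Variables (m1 : {sigma_finite_measure set T1 -> \bar R})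
  (m2 : {sigma_finite_measure set T2 -> \bar R}).

(** Tonelli's theorem for the indicator of the complement of [Q]: its integral over almost every
    fibre is 0. *)
Lemma ae_product_ysection (Q : set (T1 * T2)) : measurable Q ->
  {ae m2, forall y, {ae m1, forall x, Q (x, y)}} -> {ae (m1 \x m2)%E, forall p, Q p}.
Proof.
move=> mQ aeQ; have mQC : measurable (~` Q) by exact: measurableC.
exists (~` Q); split => //.
pose q : T1 * T2 -> \bar R := fun p => (\1_(~` Q) p)%:E.
have mq : measurable_fun setT q by exact/measurable_EFinP/measurable_indic.
have q0 p : (0 <= q p)%E by rewrite lee_fin.
transitivity (\int[m1 \x m2]_p q p)%E; first by rewrite integral_indic// setIT.
rewrite fubini_tonelli2//.
rewrite (ae_eq_integral (cst 0%E))//; first by rewrite integral0.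
- exact: measurable_fun_fubini_tonelli_G.
have FF2 := ae_filter_ringOfSetsType m2.
apply: filterS aeQ => y aeQy _.
rewrite /fubini_G (ae_eq_integral (cst 0%E))//; first by rewrite integral0.
- exact: measurableT_comp.
have FF1 := ae_filter_ringOfSetsType m1.
apply: filterS aeQy => x Qxy _.
by rewrite /q indicE memNset//= => nQ; exact: nQ.
Qed.

End ae_product.

(** * Partial derivatives as derivatives along a fibre *)

Section partial_derivative.
Context {R : realType} {n : nat} (i : 'I_n.+1) (g : 'rV[R]_n.+1 -> R).

Lemma insrV_shift (t x : R) z :
  insrV i (t + x, z) = t *: delta_mx ord0 i + insrV i (x, z).
Proof.
apply/rowP => j; rewrite !mxE/=; case: (unliftP i j) => [k|] -> /=.
  by rewrite eq_sym (negbTE (neq_lift _ _)) mulr0 add0r.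
by rewrite eqxx mulr1.
Qed.

(** The difference quotients along the [i]-th axis are those of the restriction of [g] to the fibre,
    so both the existence and the value of the limit transfer. *)
Let quotientE (x : R) z :
  (fun t : R => t^-1 *: ((g \o shift (insrV i (x, z))) (t *: delta_mx ord0 i) -
                         g (insrV i (x, z)))) =
  (fun t => t^-1 *: (((fun x => g (insrV i (x, z))) \o shift x) (t *: 1) -
                     g (insrV i (x, z)))).
Proof. by apply/funext => t; rewrite /= -insrV_shift [t *: 1]mulr1. Qed.

Lemma derive_insrV z x :
  'D_1 (fun x : R => g (insrV i (x, z))) x = partial g i (insrV i (x, z)).
Proof. by rewrite /partial /derive quotientE. Qed.

Lemma derivable_insrV z x : differentiable g (insrV i (x, z)) ->
  derivable (fun x : R => g (insrV i (x, z))) x 1.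
Proof.
move=> /(@diff_derivable _ _ _ g _ (delta_mx ord0 i)).
by rewrite /derivable quotientE.
Qed.

End partial_derivative.

(** * The pointwise bound on the input density *)

Section density_bound.
Context {R : realType} disp (T : measurableType disp) (P : probability T R) (n : nat).
Variables (X : T -> 'rV[R]_n.+1) (fX : 'rV[R]_n.+1 -> R) (g : 'rV[R]_n.+1 -> R).
Variables (i : 'I_n.+1) (k : measurableTypeR R * 'rV[R]_n -> R).
Hypotheses (mX : measurable_fun setT X) (dg : forall x, differentiable g x).
Hypothesis X_density : is_density P (lebesgue_rV R n.+1) X fX.
Hypothesis gX_density : is_density P (@lebesgue_measure R \x lebesgue_rV R n)%E
  (fun w => (g (X w), col' i (X w) : 'rV[R]_n)) k.

Local Notation m := (@lebesgue_measure R \x lebesgue_rV R n)%E.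

(** Splitting off a coordinate preserves Lebesgue measure, so no Jacobian factor appears. *)
Lemma is_density_split :
  is_density P m (fun w => (X w ord0 i, col' i (X w) : 'rV[R]_n)) (fX \o insrV i).
Proof.
have [mfX fX0 PX] := X_density; split.
- by apply: measurableT_comp => //; exact: measurable_insrV.
- by move=> p /=.
move=> A mA.
pose A' := [set v : 'rV[R]_n.+1 | A (v ord0 i, col' i v : 'rV[R]_n)].
have mA' : measurable A'.
  rewrite -[X in measurable X]setTI.
  apply: (measurable_fun_pair (measurable_coord i) (measurable_col' i)) => //.
transitivity (pushforward P X A') => //.
rewrite PX//.
transitivity (\int[pushforward m (insrV i)]_(v in A') (fX v)%:E)%E.
  apply: eq_measure_integral; first exact: measurable_insrV.
  by move=> mi B mB _; exact: (lebesgue_rV_insrV i mB).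
rewrite ge0_integral_pushforward//.
- congr (integral _ _ _); apply/seteqP.
  by split => p; rewrite /A'/= insrV_coord col'_insrV; case: p.
- exact: measurable_insrV.
- exact/measurable_funTS/measurable_EFinP.
- by move=> v _; rewrite lee_fin.
Qed.

Let f := fX \o insrV i.
Let G := g \o insrV i.

Let cg : continuous g. Proof. by move=> x; exact: differentiable_continuous. Qed.
Let mg : measurable_fun setT g. Proof. exact: continuous_rV_measurable_fun. Qed.
Let mG : measurable_fun setT G.
Proof. by apply: measurableT_comp => //; exact: measurable_insrV. Qed.

Lemma density_le_partial :
  {ae P, forall w, fX (X w) <= `|partial g i (X w)| * k (g (X w), col' i (X w))}.
Proof.
have [mk k0 Pk] := gX_density.
have [mf f0 Pf] := is_density_split.
have intf := is_density_integrable is_density_split.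
have intk := is_density_integrable gX_density.
have msplit : measurable_fun setT
    (fun w => (X w ord0 i, col' i (X w)) : measurableTypeR R * 'rV[R]_n).
  apply: measurable_fun_pair.
    exact: (measurableT_comp (measurable_coord i)).
  exact: (measurableT_comp (measurable_col' i)).
pose bound (p : measurableTypeR R * 'rV[R]_n) := `|partial g i (insrV i p)| * k (G p, p.2).
(* The split input has density [f] with respect to [m], so sets null for [m] are negligible under
   [P]. *)
suff : {ae m, forall p, f p <= bound p}.
  move=> /(is_density_ae msplit is_density_split).
  have FF := ae_filter_ringOfSetsType P.
  by apply: filterS => w /=; rewrite /f /bound /G /= insrVK.
apply: (@ae_product_ysection _ _ _ _ _ _ _ [set p | f p <= bound p]).
  have mbound : measurable_fun setT bound.
    apply: measurable_funM.
      apply: measurableT_comp => //; apply: measurableT_comp (measurable_insrV i).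
      exact: measurable_derive_rV.
    by apply: measurableT_comp => //; apply: measurable_fun_pair.
  rewrite -[X in measurable X]setTI.
  rewrite (_ : [set p | _] = [set p | ((f p)%:E <= (bound p)%:E)%E]); last first.
    by apply/seteqP; split => p /=; rewrite lee_fin.
  by apply: measurable_lee => //; exact/measurable_EFinP.
have fGk A : measurable A ->
  (\int[m]_(p in (fun p => (G p, p.2)) @^-1` A) (f p)%:E = \int[m]_(p in A) (k p)%:E)%E.
  (* Both integrals are the probability that (Y, X_{~i}) lies in [A]. *)
  move=> mA; rewrite -Pk// -Pf.
    by rewrite /pushforward; congr (P _); apply/seteqP; split => w /=; rewrite /G /= insrVK.
  rewrite -[X in measurable X]setTI; apply: measurable_fun_pair => //.
have FF := ae_filter_ringOfSetsType (lebesgue_rV R n).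
have aeG := ae_fibre_pushforward intf intk f0 k0 mG fGk.
near=> z.
have fG_z : forall B, measurable B ->
    (\int[lebesgue_measure]_(x in [set x | B (G (x, z))]) (f (x, z))%:E =
     \int[lebesgue_measure]_(x in B) (k (x, z))%:E)%E.
  by near: z; exact: aeG.
have intf_z : lebesgue_measure.-integrable setT (fun x => (f (x, z))%:E).
  by near: z; exact: (ae_integrable2 intf).
have intk_z : lebesgue_measure.-integrable setT (fun x => (k (x, z))%:E).
  by near: z; exact: (ae_integrable2 intk).
have := @pushforward_density_le R (fun x => f (x, z)) (fun x => k (x, z)) (fun x => G (x, z))
  intf_z intk_z (fun x => f0 (x, z)) (fun x => k0 (x, z))
  (fun x => derivable_insrV (dg _)) fG_z.
have FF1 := ae_filter_ringOfSetsType (@lebesgue_measure R).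
by apply: filterS => x /=; rewrite derive_insrV.
Unshelve. all: by end_near. Qed.

End density_bound.

(** * Entropies *)

(** On nonnegative reals the inverse is the power -1, also at 0, where both are 0. *)
Lemma measurable_fun_div_ge0 d (T : measurableType d) (R : realType) (f h : T -> R) :
  measurable_fun setT f -> measurable_fun setT h -> (forall x, 0 <= h x) ->
  measurable_fun setT (fun x => f x / h x).
Proof.
move=> mf mh h0; apply: measurable_funM => //.
rewrite (_ : (fun x => (h x)^-1) = (@powR R ^~ (-1)) \o h); last first.
  by apply/funext => x /=; rewrite powR_inv1.
exact: (measurableT_comp (measurable_powR _)).
Qed.

(** Integrability makes the product finite almost everywhere, which excludes a zero derivative where
    [fX] is positive; where [fX] vanishes both sides are 0. *)
Lemma log_partial_fin (R : realType) n (g fX : 'rV[R]_n -> R) i :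
  (forall x, 0 <= fX x) -> finite_expected_log_derivative g fX i ->
  {ae lebesgue_rV R n, forall x,
     (log_partial g i x * (fX x)%:E = (fX x * ln `|partial g i x|)%:E)%E}.
Proof.
move=> fX0 /(integrable_ae measurableT).
have FF := ae_filter_ringOfSetsType (lebesgue_rV R n).
apply: filterS => x /(_ I); rewrite /log_partial.
have [->|fx0] := eqVneq (fX x) 0; first by rewrite mule0 mul0r.
have [->|gx0] := eqVneq (partial g i x) 0.
  (* Here the product is -oo, against its finiteness. *)
  rewrite normr0 le0_lneNy// mulNyr gtr0_sg ?mul1e//.
  by rewrite lt_def fx0 fX0.
by rewrite lne_EFin ?normr_gt0// -EFinM mulrC.
Qed.

(** * Gibbs' inequality for the product of the marginals *)

Section total_effect_entropy.
Context {R : realType} disp (T : measurableType disp) (P : probability T R) (n : nat).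
Variables (X : T -> 'rV[R]_n.+1) (fX : 'rV[R]_n.+1 -> R) (g : 'rV[R]_n.+1 -> R).
Variables (i : 'I_n.+1) (k : measurableTypeR R * 'rV[R]_n -> R).
Variables (fXi : R -> R) (fXni : 'rV[R]_n -> R).
Hypotheses (mX : measurable_fun setT X) (dg : forall x, differentiable g x).
Hypothesis X_density : is_density P (lebesgue_rV R n.+1) X fX.
Hypothesis gX_density : is_density P (@lebesgue_measure R \x lebesgue_rV R n)%E
  (fun w => (g (X w), col' i (X w) : 'rV[R]_n)) k.
Hypothesis Xi_density : is_density P (@lebesgue_measure R) (fun w => X w ord0 i) fXi.
Hypothesis Xni_density : is_density P (lebesgue_rV R n)
  (fun w => col' i (X w) : 'rV[R]_n) fXni.
Local Notation m := (@lebesgue_measure R \x lebesgue_rV R n)%E.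
Hypothesis HXi_fin : finite_entropy (@lebesgue_measure R) fXi.
Hypothesis HT_fin : finite_conditional_entropy m k fXni.
Hypothesis l_fin : finite_expected_log_derivative g fX i.

Let Xi w : measurableTypeR R := X w ord0 i.
Let Xni w : 'rV[R]_n := col' i (X w).
Let Y w : measurableTypeR R := g (X w).

Let mXi : measurable_fun setT Xi.
Proof. exact: (measurableT_comp (measurable_coord i)). Qed.
Let mXni : measurable_fun setT Xni.
Proof. exact: (measurableT_comp (measurable_col' i)). Qed.
Let mg : measurable_fun setT g.
Proof.
by apply: continuous_rV_measurable_fun => x; exact: differentiable_continuous.
Qed.
Let mY : measurable_fun setT Y.
Proof. exact: (measurableT_comp mg). Qed.
Let mYXni : measurable_fun setT (fun w => (Y w, Xni w)).
Proof. exact: measurable_fun_pair. Qed.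
Let mXiXni : measurable_fun setT (fun w => (Xi w, Xni w)).
Proof. exact: measurable_fun_pair. Qed.

(** Entropies and the log-derivative become expectations under the single measure [P]. [ratio] is
    the likelihood ratio of the product of the marginals of X_i and X_{~i} to the joint density. *)
Let lnT w := ln (conditional_density k fXni (Y w, Xni w)).
Let lnXi w := ln (fXi (Xi w)).
Let lnD w := ln `|partial g i (X w)|.
Let ratio w := fXi (Xi w) * fXni (Xni w) / fX (X w).

Let mconditional : measurable_fun setT (fun p => ln (conditional_density k fXni p)).
Proof.
have [mk k0 _] := gX_density; have [mf f0 _] := Xni_density.
apply: (measurableT_comp (@measurable_ln R)).
apply: measurable_fun_div_ge0 => //.
by apply: measurableT_comp => //; exact: measurable_snd.
Qed.

Lemma conditional_entropyE : P.-integrable setT (EFin \o lnT) /\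
  (conditional_entropy m k fXni = - \int[P]_w (lnT w)%:E)%E.
Proof.
split; first exact: (integrable_is_density mYXni gX_density mconditional HT_fin).
by congr (- _)%E; exact/esym/(integral_is_density mYXni gX_density mconditional).
Qed.

Lemma marginal_entropyE : P.-integrable setT (EFin \o lnXi) /\
  (entropy (@lebesgue_measure R) fXi = - \int[P]_w (lnXi w)%:E)%E.
Proof.
have [mf f0 _] := Xi_density.
have mln : measurable_fun setT (fun x => ln (fXi x)).
  exact: (measurableT_comp (@measurable_ln R) mf).
split; first exact: (integrable_is_density mXi Xi_density mln HXi_fin).
by congr (- _)%E; exact/esym/(integral_is_density mXi Xi_density mln).
Qed.

Let mpartial : measurable_fun setT (partial g i).
Proof. exact: measurable_derive_rV. Qed.

Lemma expected_log_derivativeE : P.-integrable setT (EFin \o lnD) /\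
  (expected_log_derivative g fX i = \int[P]_w (lnD w)%:E)%E.
Proof.
have [mf f0 _] := X_density.
have mln : measurable_fun setT (fun x => ln `|partial g i x|).
  exact: (measurableT_comp (@measurable_ln R)
    (measurableT_comp (@normr_measurable R setT) mpartial)).
have mfln : measurable_fun setT (fun x => (fX x * ln `|partial g i x|)%:E).
  by apply/measurable_EFinP; exact: measurable_funM.
(* Passes from the extended logarithm to [ln]; their different values at 0 matter only on a null set
   once weighted by [fX]. *)
have fin := log_partial_fin f0 l_fin.
have FF := ae_filter_ringOfSetsType (lebesgue_rV R n.+1).
have lE : ae_eq (lebesgue_rV R n.+1) setT
    (fun x => log_partial g i x * (fX x)%:E)%E (fun x => (fX x * ln `|partial g i x|)%:E).
  by apply: filterS fin => x + _.
have [mlf loo] := integrableP _ _ _ l_fin.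
have int : (lebesgue_rV R n.+1).-integrable setT (fun x => (fX x * ln `|partial g i x|)%:E).
  apply/integrableP; split => //; move: loo; congr (_ < _)%E.
  apply: ae_eq_integral => //.
  - exact: measurableT_comp.
  - exact: measurableT_comp.
  by apply: filterS fin => x -> _.
have ints := (integrable_support _ _ mf).2 int.
split; first exact: (integrable_is_density mX X_density mln ints).
rewrite [RHS](integral_is_density mX X_density mln) integral_support.
exact: ae_eq_integral.
Qed.

(** In the expectation [fX] cancels on its support, leaving the mass that the product density has
    there; the total mass of that density is 1. *)
Lemma integral_ratio_le1 : P.-integrable setT (EFin \o ratio) /\
  (\int[P]_w (ratio w)%:E <= 1)%E.
Proof.
have split_density := is_density_split i X_density.
have [mf f0 _] := split_density.
have [mfi fi0 _] := Xi_density; have [mfni fni0 _] := Xni_density.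
pose prod (p : measurableTypeR R * 'rV[R]_n) : R := fXi p.1 * fXni p.2.
have mprod : measurable_fun setT prod.
  apply: measurable_funM; first exact: (measurableT_comp mfi measurable_fst).
  exact: (measurableT_comp mfni measurable_snd).
have mprodE : measurable_fun setT (EFin \o prod) by exact/measurable_EFinP.
have prod0 p : 0 <= prod p by rewrite mulr_ge0.
pose q p := prod p / (fX \o insrV i) p.
have mq : measurable_fun setT q by exact: measurable_fun_div_ge0.
have q0 p : 0 <= q p by rewrite divr_ge0.
have ratioE w : ratio w = q (Xi w, Xni w) by rewrite /q /= insrVK.
have le1 : (\int[P]_w (ratio w)%:E <= 1)%E.
  under eq_integral do rewrite ratioE.
  rewrite (ge0_integral_is_density mXiXni split_density (phi := EFin \o q)); last 2 first.
  - exact/measurable_EFinP.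
  - by move=> p; rewrite lee_fin.
  apply: (@le_trans _ _ (\int[m]_p (prod p)%:E)%E).
    apply: ge0_le_integral => //.
    + by move=> p _; rewrite -EFinM lee_fin mulr_ge0.
    + by apply/measurable_EFinP; exact: measurable_funM.
    + move=> p _; rewrite -EFinM lee_fin /q.
      (* Where the joint density vanishes the left side is 0; elsewhere equality holds. *)
      have [->|fp0] := eqVneq ((fX \o insrV i) p) 0; first by rewrite mulr0.
      by rewrite divfK.
  rewrite fubini_tonelli1//.
  rewrite (eq_integral (fun x : measurableTypeR R => (fXi x)%:E)); last first.
    move=> x _; rewrite /fubini_F /prod/=.
    under eq_integral do rewrite EFinM.
    rewrite ge0_integralZl//.
    - by rewrite (is_density_integral1 Xni_density) mule1.
    - exact/measurable_EFinP.
    - by move=> z _; rewrite lee_fin.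
    - by rewrite lee_fin.
  by rewrite (is_density_integral1 Xi_density).
split=> //; apply/integrableP; split.
  apply/measurable_EFinP; rewrite (_ : ratio = q \o (fun w => (Xi w, Xni w))); last first.
    by apply/funext => w; exact: ratioE.
  exact: measurableT_comp.
under eq_integral do rewrite /= ger0_norm ?ratioE//.
by under eq_integral do rewrite -ratioE; rewrite (le_lt_trans le1)// ltry.
Qed.

(* [lnXi - lnT - lnD] is the logarithm of fXi fXni / (k |dg/dx_i|), which is at
   most [ratio] by [density_le_partial]. *)
Lemma ae_log_ratio_le :
  {ae P, forall w, lnXi w - lnT w - lnD w <= ratio w - 1}.
Proof.
have FF := ae_filter_ringOfSetsType P.
have [_ fX0 _] := X_density; have [_ k0 _] := gX_density.
have [_ fXi0 _] := Xi_density; have [_ fXni0 _] := Xni_density.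
have key := density_le_partial mX dg X_density gX_density.
have ae1 := is_density_neq0 mX X_density.
have ae2 := is_density_neq0 mXi Xi_density.
have ae3 := is_density_neq0 mXni Xni_density.
apply: (filterS3 _ _ ae1 ae2 (filterI key ae3)) => w F_neq0 c_neq0 [{}key b_neq0].
rewrite /lnT /lnXi /lnD /ratio /conditional_density /= -/(Xni w) -/(Y w) -/(Xi w)
  in key c_neq0 b_neq0 *.
have F0 : 0 < fX (X w) by rewrite lt_def F_neq0 fX0.
have c0 : 0 < fXi (Xi w) by rewrite lt_def c_neq0 fXi0.
have b0 : 0 < fXni (Xni w) by rewrite lt_def b_neq0 fXni0.
(* Positivity of [fX] and the pointwise bound force [k] and the partial derivative to be nonzero, so
   no logarithm below takes its default value. *)
have Da0 : 0 < `|partial g i (X w)| * k (Y w, Xni w) := lt_le_trans F0 key.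
have a0 : 0 < k (Y w, Xni w).
  by rewrite lt_def k0 andbT; apply: contraTneq Da0 => ->; rewrite mulr0 ltxx.
have D0 : 0 < `|partial g i (X w)| by rewrite -(pmulr_lgt0 _ a0).
have r0 : 0 < fXi (Xi w) * fXni (Xni w) / fX (X w) by rewrite divr_gt0 ?mulr_gt0.
(* The inequality ln(1 + x) <= x at x = ratio - 1. *)
have := @le_ln1Dx R (fXi (Xi w) * fXni (Xni w) / fX (X w) - 1).
rewrite ltrBrDr addNr addrC subrK => /(_ r0); apply: le_trans.
rewrite !ln_div ?posrE ?mulr_gt0// lnM ?posrE//.
have : ln (fX (X w)) <= ln (`|partial g i (X w)| * k (Y w, Xni w)) by rewrite ler_ln ?posrE.
rewrite lnM ?posrE//; lra.
Qed.

Lemma conditional_entropy_le :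
  (conditional_entropy m k fXni <=
   entropy (@lebesgue_measure R) fXi + expected_log_derivative g fX i)%E.
Proof.
have [iT ->] := conditional_entropyE; have [iXi ->] := marginal_entropyE.
have [iD ->] := expected_log_derivativeE; have [iratio ratio1] := integral_ratio_le1.
have i1 : P.-integrable setT (EFin \o (fun=> 1 : R)).
  exact: finite_measure_integrable_cst.
have iXT : P.-integrable setT (EFin \o (fun w => lnXi w - lnT w)).
  exact: (integrableB measurableT iXi iT).
have iXTD : P.-integrable setT (EFin \o (fun w => lnXi w - lnT w - lnD w)).
  exact: (integrableB measurableT iXT iD).
have ir1 : P.-integrable setT (EFin \o (fun w => ratio w - 1)).
  exact: (integrableB measurableT iratio i1).
(* [h] is the gap in [ae_log_ratio_le]. Nonnegativity of its mean, combined with the mean of [ratio]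
   being at most 1, is the claim. *)
pose h w := (ratio w - 1) - (lnXi w - lnT w - lnD w).
have ih : P.-integrable setT (EFin \o h) by exact: (integrableB measurableT ir1 iXTD).
have h0 : (0 <= \int[P]_w h w)%R.
  (* An inequality valid only almost everywhere is used by exchanging [h] for its absolute value. *)
  rewrite /Rintegral (ae_eq_integral (fun w => `|h w|%:E)%E)//.
  - by apply: fine_ge0; apply: integral_ge0 => w _; rewrite lee_fin.
  - exact: measurable_int ih.
  - apply/measurable_EFinP; apply: measurableT_comp => //.
    by apply/measurable_EFinP; exact: measurable_int ih.
  have FF := ae_filter_ringOfSetsType P.
  by apply: filterS ae_log_ratio_le => w hw _ /=; rewrite ger0_norm// subr_ge0.
have hE : (\int[P]_w h w = (\int[P]_w ratio w - 1) -
    (\int[P]_w lnXi w - \int[P]_w lnT w - \int[P]_w lnD w))%R.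
  rewrite RintegralB// RintegralB// RintegralB// RintegralB//; congr (_ - _ - _)%R.
  by rewrite Rintegral_cst//= probability_setT mulr1.
have finE f : P.-integrable setT (EFin \o f) ->
    (\int[P]_w (f w)%:E = (\int[P]_w f w)%R%:E)%E.
  by move=> intf; rewrite /Rintegral fineK//; exact: integrable_fin_num.
move: ratio1; rewrite !finE// -!EFinN -EFinD !lee_fin; lra.
Qed.

End total_effect_entropy.

Unset Implicit Arguments.
Set Strict Implicit.
Set Printing Implicit Defensive.

Theorem mainTheorem1 (R : realType) (disp : measure_display)
    (T : measurableType disp) (P : probability T R) (d : nat)
    (X : {RV P >-> 'rV[R]_d}) (fX : 'rV[R]_d -> R)
    (X_density : is_density P (@lebesgue_rV R d) X fX)
    (g : 'rV[R]_d -> R)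
    (g_diff : forall x, differentiable g x)
    (g_sqr : forall j : 'I_d,
      ('E_P[fun w => (partial g j (X w) ^+ 2)%R] < +oo)%E)
    (i : 'I_d)
    (* Y = g(X) *)
    (Y : T -> R) (YE : Y = g \o X)
    (fXi : R -> R)
    (Xi_density : is_density P (@lebesgue_measure R) (fun w => X w ord0 i) fXi)
    (fXni : 'rV[R]_d.-1 -> R)
    (Xni_density : is_density P (@lebesgue_rV R d.-1) (fun w => col' i (X w)) fXni)
    (fYXni : measurableTypeR R * 'rV[R]_d.-1 -> R)
    (YXni_density : is_density P (@lebesgue_measure R \x @lebesgue_rV R d.-1)%E
      (fun w => (Y w, col' i (X w))) fYXni)
    (HX_fin : finite_entropy (@lebesgue_rV R d) fX)
    (HXi_fin : finite_entropy (@lebesgue_measure R) fXi)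
    (HXni_fin : finite_entropy (@lebesgue_rV R d.-1) fXni)
    (HYXni_fin :
      finite_entropy (@lebesgue_measure R \x @lebesgue_rV R d.-1)%E fYXni)
    (HT_fin : finite_conditional_entropy
      (@lebesgue_measure R \x @lebesgue_rV R d.-1)%E fYXni fXni)
    (l_fin : finite_expected_log_derivative g fX i) :
  (conditional_entropy (@lebesgue_measure R \x @lebesgue_rV R d.-1)%E fYXni fXni
    <= entropy (@lebesgue_measure R) fXi + expected_log_derivative g fX i)%E.
Proof.
(* The index [i] excludes dimension 0; for [d = n.+1] the dimension [d.-1] of x_{~i} reduces to
   [n]. *)
subst Y; destruct d as [|n]; first by have := ltn_ord i; rewrite ltn0.
exact: (conditional_entropy_le (measurable_funP X) g_diff X_density YXni_density
  Xi_density Xni_density HXi_fin HT_fin l_fin).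
Qed.
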